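(* Let $\mathcal{C}$ be a multiring category over $\Bbbk$ with left duals, with unit decomposition $1=\oplus_{i\in I}1_i$, and let $J$ be a non-empty subset of $I$. (1) Let $(A,m_A,u_A)$ be an algebra in $\mathcal{C}$. Then $A_J$ is an algebra in $\mathcal{C}_J$ for which the multiplication $m_{A_J}$ and the unit $u_{A_J}:1_J\to A_J$ satisfy $i_{A_J}m_{A_J}=m_A(i_{A_J}\otimes i_{A_J})$ and $i_{A_J}u_{A_J}p_J=u_A$, where $i_{A_J}:=i_J\otimes\mathrm{Id}_A\otimes i_J:1_J\otimes A\otimes 1_J\to A$ is the canonical inclusion. (2) Let $(C,\Delta_C,\varepsilon_C)$ be a coalgebra in $\mathcal{C}$. Then $C_J$ is a coalgebra in $\mathcal{C}_J$ for which the comultiplication $\Delta_{C_J}$ and the counit $\varepsilon_{C_J}:C_J\to 1_J$ satisfy $\Delta_{C_J}p_{C_J}=(p_{C_J}\otimes p_{C_J})\Delta_C$ and $i_J\varepsilon_{C_J}p_{C_J}=\varepsilon_C$, where $p_{C_J}:=p_J\otimes\mathrm{Id}_C\otimes p_J:C\to 1_J\otimes C\otimes 1_J$ is the canonical projection.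
   Context: $\Bbbk$ is an algebraically closed field; monoidal categories are assumed strict, with tensor product $\otimes$ and unit object $1$. A multiring category over $\Bbbk$ is a locally finite (finite-dimensional Hom spaces, all objects of finite length) $\Bbbk$-linear abelian monoidal category with bilinear and biexact tensor product. ''With left duals'' means every object has a left dual. For such $\mathcal{C}$ the unit object is a finite direct sum $1=\oplus_{i\in I}1_i$ of pairwise non-isomorphic simple objects $1_i$ (the images of the primitive idempotents of $\mathrm{End}(1)$), $1_i\otimes 1_j=0$ for $i\neq j$, and $\mathcal{C}=\oplus_{i,j\in I}\mathcal{C}_{ij}$ with $\mathcal{C}_{ij}=1_i\otimes\mathcal{C}\otimes 1_j$. For a non-empty $J\subseteq I$: $\mathcal{C}_J:=\oplus_{i,j\in J}\mathcal{C}_{ij}$ (full subcategory of $\mathcal{C}$), $1_J:=\oplus_{i\in J}1_i$, and $p_J:1\to 1_J$, $i_J:1_J\to 1$ are the canonical projection and inclusion. $\mathcal{C}_J$ is monoidal with the tensor product of $\mathcal{C}$, unit object $1_J$, and unit constraints $l^J_X=i_J\otimes\mathrm{Id}_X$, $r^J_X=\mathrm{Id}_X\otimes i_J$. For an object $X$ of $\mathcal{C}$, $X_J:=1_J\otimes X\otimes 1_J$.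
   Formalization: The printed unit and counit identities fail for J≠I (take A=C=1 with identity structure maps); they are replaced by i_{A_J}u_{A_J}p_J = u_A i_J p_J and i_J ε_{C_J} p_{C_J} = i_J p_J ε_C, which give the printed ones whenever those can hold. *)

(* Defs.v *)
From HB Require Import structures.
From mathcomp Require Import all_boot all_algebra.

Set Implicit Arguments.
Unset Strict Implicit.
Unset Printing Implicit Defensive.

Import GRing.Theory.
Local Open Scope ring_scope.

Declare Scope cat_scope.
Delimit Scope cat_scope with cat.

(* k-linear categories with finite-dimensional Hom spaces.  Finite            *)
(* dimensionality of Hom is carried by [vectType].                            *)
Record linCategory (k : fieldType) := LinCategory {
  ob :> Type;
  mor : ob -> ob -> vectType k;
  idm : forall X, mor X X;
  mcomp : forall X Y Z, mor Y Z -> mor X Y -> mor X Z;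
  mcompA : forall W X Y Z (h : mor Y Z) (g : mor X Y) (f : mor W X),
    mcomp h (mcomp g f) = mcomp (mcomp h g) f;
  mcomp1m : forall X Y (f : mor X Y), mcomp (idm Y) f = f;
  mcompm1 : forall X Y (f : mor X Y), mcomp f (idm X) = f;
  mcomp_linearl : forall X Y Z (f : mor X Y),
    linear ((fun g => mcomp g f) : mor Y Z -> mor X Z);
  mcomp_linearr : forall X Y Z (g : mor Y Z),
    linear (mcomp g : mor X Y -> mor X Z)
}.

Arguments mor {k l} X Y.
Arguments idm {k l} X.
Arguments mcomp {k l X Y Z} g f.

Notation "g \o f" := (mcomp g f) : cat_scope.
Local Open Scope cat_scope.

Section LinearCategories.
Variables (k : fieldType) (C : linCategory k).
Implicit Types X Y Z : C.

Definition is_mono X Y (f : mor X Y) :=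
  forall W (g h : mor W X), f \o g = f \o h -> g = h.

Definition is_epi X Y (f : mor X Y) :=
  forall Z (g h : mor Y Z), g \o f = h \o f -> g = h.

Definition is_iso X Y (f : mor X Y) :=
  exists g : mor Y X, g \o f = idm X /\ f \o g = idm Y.

Definition isomorphic X Y := exists f : mor X Y, is_iso f.

Definition zero_object Z :=
  (forall X (f : mor X Z), f = 0) /\ (forall X (f : mor Z X), f = 0).

Definition is_kernel K X Y (f : mor X Y) (i : mor K X) :=
  f \o i = 0 /\
  forall W (h : mor W X), f \o h = 0 -> exists! h' : mor W K, i \o h' = h.

Definition is_cokernel X Y Q (f : mor X Y) (p : mor Y Q) :=
  p \o f = 0 /\
  forall W (h : mor Y W), h \o f = 0 -> exists! h' : mor Q W, h' \o p = h.

Definition short_exact X Y Z (f : mor X Y) (g : mor Y Z) :=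
  is_kernel g f /\ is_cokernel f g.

Record direct_sum (T : finType) (F : T -> C) (S : C) := DirectSum {
  dinj : forall t, mor (F t) S;
  dproj : forall t, mor S (F t);
  dprojK : forall t, dproj t \o dinj t = idm (F t);
  dproj0 : forall s t, s != t -> dproj s \o dinj t = 0;
  dsum1 : \sum_t (dinj t \o dproj t) = idm S
}.

(* The empty family gives the zero object. *)
Record abelian_category : Prop := AbelianCategory {
  ab_sum : forall (T : finType) (F : T -> C),
    exists S, inhabited (direct_sum F S);
  ab_ker : forall X Y (f : mor X Y), exists K (i : mor K X), is_kernel f i;
  ab_coker : forall X Y (f : mor X Y), exists Q (p : mor Y Q), is_cokernel f p;
  ab_mono : forall X Y (f : mor X Y),
    is_mono f -> exists Z (g : mor Y Z), is_kernel g f;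
  ab_epi : forall X Y (f : mor X Y),
    is_epi f -> exists W (g : mor W X), is_cokernel g f
}.

Definition simple_object X :=
  ~ zero_object X /\
  forall Y (f : mor Y X), is_mono f -> zero_object Y \/ is_iso f.

(* Existence of a finite composition series. *)
Inductive finite_length : C -> Prop :=
| finite_length_zero X : zero_object X -> finite_length X
| finite_length_ext X Y S (f : mor Y X) (g : mor X S) :
    short_exact f g -> simple_object S -> finite_length Y -> finite_length X.

Lemma mcompDl X Y Z (g h : mor Y Z) (f : mor X Y) :
  (g + h) \o f = (g \o f) + (h \o f).
Proof. by have := mcomp_linearl f 1 g h; rewrite /= !scale1r. Qed.

Lemma mcompDr X Y Z (g : mor Y Z) (f h : mor X Y) :
  g \o (f + h) = (g \o f) + (g \o h).
Proof. by have := mcomp_linearr g 1 f h; rewrite /= !scale1r. Qed.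

Lemma mcomp0l X Y Z (f : mor X Y) : (0 : mor Y Z) \o f = 0.
Proof. by apply: (addrI (0 \o f)); rewrite -mcompDl !addr0. Qed.

Lemma mcomp0r X Y Z (g : mor Y Z) : g \o (0 : mor X Y) = 0.
Proof. by apply: (addrI (g \o 0)); rewrite -mcompDr !addr0. Qed.

Lemma mcomp_suml X Y Z (T : finType) (P : pred T) (g : T -> mor Y Z)
    (f : mor X Y) :
  (\sum_(t | P t) g t) \o f = \sum_(t | P t) (g t \o f).
Proof.
apply: (big_morph (fun u : mor Y Z => u \o f)); last exact: mcomp0l.
by move=> u v; exact: mcompDl.
Qed.

Lemma mcomp_sumr X Y Z (T : finType) (P : pred T) (g : mor Y Z)
    (f : T -> mor X Y) :
  g \o (\sum_(t | P t) f t) = \sum_(t | P t) (g \o f t).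
Proof.
apply: (big_morph (fun u : mor X Y => g \o u)); last exact: mcomp0r.
by move=> u v; exact: mcompDr.
Qed.

Lemma direct_sum_iso (T : finType) (F : T -> C) S X (f : mor X S)
    (g : mor S X) : g \o f = idm X -> f \o g = idm S ->
  direct_sum F S -> direct_sum F X.
Proof.
move=> gf fg B.
exists (fun t => g \o dinj B t) (fun t => dproj B t \o f).
- by move=> t; rewrite mcompA -(mcompA _ f) fg mcompm1 dprojK.
- by move=> s t st; rewrite mcompA -(mcompA _ f) fg mcompm1 dproj0.
rewrite -gf -[X in _ = X \o f]mcompm1 -(dsum1 B) mcomp_sumr mcomp_suml.
by apply: eq_bigr => t _; rewrite !mcompA.
Qed.

End LinearCategories.

Reserved Notation "X \ox Y" (at level 40, left associativity).
Reserved Notation "f \oxm g" (at level 40, left associativity).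

(* Monoidal structure with bilinear tensor product; associativity and unit    *)
(* constraints are part of the data, so strict categories are those in which  *)
(* they are identities.                                                       *)
Record monCategory (k : fieldType) := MonCategory {
  mcat :> linCategory k;
  tens : mcat -> mcat -> mcat
    where "X \ox Y" := (tens X Y);
  tensm : forall X X' Y Y' : mcat,
    mor X X' -> mor Y Y' -> mor (X \ox Y) (X' \ox Y')
    where "f \oxm g" := (tensm f g);
  unitob : mcat;
  assoc : forall X Y Z, mor ((X \ox Y) \ox Z) (X \ox (Y \ox Z));
  assocI : forall X Y Z, mor (X \ox (Y \ox Z)) ((X \ox Y) \ox Z);
  lun : forall X, mor (unitob \ox X) X;
  lunI : forall X, mor X (unitob \ox X);
  run : forall X, mor (X \ox unitob) X;
  runI : forall X, mor X (X \ox unitob);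
  tens1 : forall X Y, idm X \oxm idm Y = idm (X \ox Y);
  tens_comp : forall X X' X'' Y Y' Y'' (f' : mor X' X'') (f : mor X X')
      (g' : mor Y' Y'') (g : mor Y Y'),
    (f' \o f) \oxm (g' \o g) = (f' \oxm g') \o (f \oxm g);
  tens_linearl : forall X X' Y Y' (g : mor Y Y'),
    linear ((fun f => f \oxm g) : mor X X' -> mor (X \ox Y) (X' \ox Y'));
  tens_linearr : forall X X' Y Y' (f : mor X X'),
    linear (tensm f : mor Y Y' -> mor (X \ox Y) (X' \ox Y'));
  assocK : forall X Y Z, assocI X Y Z \o assoc X Y Z = idm _;
  assocIK : forall X Y Z, assoc X Y Z \o assocI X Y Z = idm _;
  lunK : forall X, lunI X \o lun X = idm _;
  lunIK : forall X, lun X \o lunI X = idm _;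
  runK : forall X, runI X \o run X = idm _;
  runIK : forall X, run X \o runI X = idm _;
  assoc_nat : forall X X' Y Y' Z Z' (f : mor X X') (g : mor Y Y')
      (h : mor Z Z'),
    assoc X' Y' Z' \o ((f \oxm g) \oxm h) =
    (f \oxm (g \oxm h)) \o assoc X Y Z;
  lun_nat : forall X Y (f : mor X Y), lun Y \o (idm unitob \oxm f) = f \o lun X;
  run_nat : forall X Y (f : mor X Y), run Y \o (f \oxm idm unitob) = f \o run X;
  pentagon : forall W X Y Z,
    assoc W X (Y \ox Z) \o assoc (W \ox X) Y Z =
    (idm W \oxm assoc X Y Z) \o assoc W (X \ox Y) Z
      \o (assoc W X Y \oxm idm Z);
  triangle : forall X Y,
    (idm X \oxm lun Y) \o assoc X unitob Y = run X \oxm idm Y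
}.

Arguments tens {k m} X Y.
Arguments tensm {k m X X' Y Y'} f g.
Arguments unitob {k m}.
Arguments assoc {k m} X Y Z.
Arguments assocI {k m} X Y Z.
Arguments lun {k m} X.
Arguments lunI {k m} X.
Arguments run {k m} X.
Arguments runI {k m} X.

Notation "X \ox Y" := (tens X Y) : cat_scope.
Notation "f \oxm g" := (tensm f g) : cat_scope.

Section Monoidal.
Variables (k : fieldType) (C : monCategory k).
Implicit Types X Y Z : C.

Definition biexact :=
  forall W X Y Z (f : mor X Y) (g : mor Y Z), short_exact f g ->
    short_exact (idm W \oxm f) (idm W \oxm g) /\
    short_exact (f \oxm idm W) (g \oxm idm W).

(* Local finiteness is [multiring_length] together with the                   *)
(* finite-dimensional Hom spaces of [linCategory].                            *)
Record multiring : Prop := Multiring {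
  multiring_abelian : abelian_category C;
  multiring_length : forall X, finite_length X;
  multiring_biexact : biexact
}.

Definition is_left_dual X X' (ev : mor (X' \ox X) unitob)
    (coev : mor unitob (X \ox X')) :=
  run X \o (idm X \oxm ev) \o assoc X X' X \o (coev \oxm idm X) \o lunI X
    = idm X /\
  lun X' \o (ev \oxm idm X') \o assocI X' X X' \o (idm X' \oxm coev)
    \o runI X' = idm X'.

Definition has_left_duals :=
  forall X,
  exists X' (ev : mor (X' \ox X) unitob) (coev : mor unitob (X \ox X')),
    is_left_dual ev coev.

Record is_algebra (A : C) (m : mor (A \ox A) A) (u : mor unitob A) : Prop :=
  IsAlgebra {
  alg_assoc : m \o (m \oxm idm A) = m \o (idm A \oxm m) \o assoc A A A;
  alg_unitl : m \o (u \oxm idm A) = lun A;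
  alg_unitr : m \o (idm A \oxm u) = run A
}.

Record is_coalgebra (A : C) (d : mor A (A \ox A)) (e : mor A unitob) : Prop :=
  IsCoalgebra {
  coalg_assoc : assoc A A A \o (d \oxm idm A) \o d = (idm A \oxm d) \o d;
  coalg_unitl : lun A \o (e \oxm idm A) \o d = idm A;
  coalg_unitr : run A \o (idm A \oxm e) \o d = idm A
}.

Lemma tensDl X X' Y Y' (f f' : mor X X') (g : mor Y Y') :
  (f + f') \oxm g = f \oxm g + f' \oxm g.
Proof. by have := tens_linearl g 1 f f'; rewrite /= !scale1r. Qed.

Lemma tensDr X X' Y Y' (f : mor X X') (g g' : mor Y Y') :
  f \oxm (g + g') = f \oxm g + f \oxm g'.
Proof. by have := tens_linearr f 1 g g'; rewrite /= !scale1r. Qed.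

Lemma tens0l X X' Y Y' (g : mor Y Y') : (0 : mor X X') \oxm g = 0.
Proof. by apply: (addrI (0 \oxm g)); rewrite -tensDl !addr0. Qed.

Lemma tens0r X X' Y Y' (f : mor X X') : f \oxm (0 : mor Y Y') = 0.
Proof. by apply: (addrI (f \oxm 0)); rewrite -tensDr !addr0. Qed.

Lemma tens_suml X X' Y Y' (T : finType) (P : pred T) (f : T -> mor X X')
    (g : mor Y Y') :
  (\sum_(t | P t) f t) \oxm g = \sum_(t | P t) f t \oxm g.
Proof.
apply: (big_morph (fun u : mor X X' => u \oxm g)); last exact: tens0l.
by move=> u v; exact: tensDl.
Qed.

Lemma tens_sumr X X' Y Y' (T : finType) (P : pred T) (f : mor X X')
    (g : T -> mor Y Y') :
  f \oxm (\sum_(t | P t) g t) = \sum_(t | P t) f \oxm g t.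
Proof.
apply: (big_morph (fun u : mor Y Y' => f \oxm u)); last exact: tens0r.
by move=> u v; exact: tensDr.
Qed.

Lemma tens_compl X X' X'' Y (f' : mor X' X'') (f : mor X X') :
  (f' \o f) \oxm idm Y = (f' \oxm idm Y) \o (f \oxm idm Y).
Proof. by rewrite -tens_comp mcomp1m. Qed.

Lemma tens_compr X Y Y' Y'' (g' : mor Y' Y'') (g : mor Y Y') :
  idm X \oxm (g' \o g) = (idm X \oxm g') \o (idm X \oxm g).
Proof. by rewrite -tens_comp mcomp1m. Qed.

Lemma section_epi (X Y : C) (f : mor X Y) (g : mor Y X) :
  f \o g = idm Y -> is_epi f.
Proof.
move=> fg Z a b; move/(congr1 (fun h => h \o g)).
by rewrite -!mcompA fg !mcompm1.
Qed.

Lemma retraction_mono (X Y : C) (f : mor X Y) (g : mor Y X) :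
  g \o f = idm X -> is_mono f.
Proof.
move=> gf W a b; move/(congr1 (mcomp g)).
by rewrite !mcompA gf !mcomp1m.
Qed.

Lemma tens1_faithfull X Y (f g : mor X Y) :
  idm unitob \oxm f = idm unitob \oxm g -> f = g.
Proof.
move=> fg; apply: (section_epi (lunIK X)).
by rewrite -!lun_nat fg.
Qed.

Lemma tens1_faithfulr X Y (f g : mor X Y) :
  f \oxm idm unitob = g \oxm idm unitob -> f = g.
Proof.
move=> fg; apply: (section_epi (runIK X)).
by rewrite -!run_nat fg.
Qed.

Lemma lun_tens X Y : lun (X \ox Y) \o assoc unitob X Y = lun X \oxm idm Y.
Proof.
apply: tens1_faithfull.
apply: (section_epi (assocIK unitob (unitob \ox X) Y)).
have aK :
  (assoc unitob unitob X \oxm idm Y) \o (assocI unitob unitob X \oxm idm Y)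
    = idm _ by rewrite -tens_compl assocIK tens1.
apply: (section_epi aK).
rewrite tens_compr -!mcompA (mcompA (idm unitob \oxm assoc _ _ _)) -pentagon.
rewrite mcompA triangle -tens1 -assoc_nat [RHS]mcompA.
by rewrite -assoc_nat -[RHS]mcompA -tens_compl triangle.
Qed.

Lemma run_tens X Y : run (X \ox Y) = (idm X \oxm run Y) \o assoc X Y unitob.
Proof.
apply: tens1_faithfulr.
apply: (retraction_mono (assocK X Y unitob)).
rewrite -triangle -tens1 mcompA assoc_nat -mcompA pentagon.
rewrite tens_compl [RHS]mcompA assoc_nat -triangle tens_compr.
by rewrite -!mcompA.
Qed.

Lemma lun_run1 : lun (@unitob _ C) = run unitob.
Proof.
apply: tens1_faithfulr; rewrite -triangle -lun_tens; congr (_ \o _).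
by apply: (retraction_mono (lunK unitob)); rewrite lun_nat.
Qed.

(* The endomorphisms of X induced by an endomorphism of the unit. *)
Definition actl (e : mor (@unitob _ C) unitob) X : mor X X :=
  lun X \o (e \oxm idm X) \o lunI X.
Definition actr (e : mor (@unitob _ C) unitob) X : mor X X :=
  run X \o (idm X \oxm e) \o runI X.

Lemma actlE e X : actl e X \o lun X = lun X \o (e \oxm idm X).
Proof. by rewrite /actl -(mcompA _ (lunI X)) lunK mcompm1. Qed.

Lemma actrE e X : actr e X \o run X = run X \o (idm X \oxm e).
Proof. by rewrite /actr -(mcompA _ (runI X)) runK mcompm1. Qed.

Lemma actl_nat e X Y (f : mor X Y) : actl e Y \o f = f \o actl e X.
Proof.
apply: (section_epi (lunIK X)).
rewrite -(mcompA (actl e Y) f) -(mcompA f (actl e X)) actlE -lun_nat.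
rewrite (mcompA (actl e Y)) actlE (mcompA f) -lun_nat -!mcompA.
by rewrite -!tens_comp !mcomp1m !mcompm1.
Qed.

Lemma actr_nat e X Y (f : mor X Y) : actr e Y \o f = f \o actr e X.
Proof.
apply: (section_epi (runIK X)).
rewrite -(mcompA (actr e Y) f) -(mcompA f (actr e X)) actrE -run_nat.
rewrite (mcompA (actr e Y)) actrE (mcompA f) -run_nat -!mcompA.
by rewrite -!tens_comp !mcomp1m !mcompm1.
Qed.

Lemma actl_tens e X Y : actl e (X \ox Y) = actl e X \oxm idm Y.
Proof.
have lK : (lun X \oxm idm Y) \o (lunI X \oxm idm Y) = idm _.
  by rewrite -tens_compl lunIK tens1.
apply: (section_epi lK).
rewrite -tens_compl actlE tens_compl -lun_tens (mcompA (actl _ _)) actlE.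
by rewrite -!mcompA assoc_nat tens1.
Qed.

Lemma actr_tens e X Y : actr e (X \ox Y) = idm X \oxm actr e Y.
Proof.
apply: (section_epi (runIK (X \ox Y))).
rewrite actrE run_tens (mcompA (idm X \oxm _)) -tens_compr.
rewrite actrE tens_compr -!mcompA.
by rewrite -assoc_nat tens1.
Qed.

Lemma actl1 e : actl e unitob = e.
Proof. by rewrite /actl lun_run1 run_nat -lun_run1 -mcompA lunIK mcompm1. Qed.

Lemma actr1 e : actr e unitob = e.
Proof. by rewrite /actr -lun_run1 lun_nat lun_run1 -mcompA runIK mcompm1. Qed.

End Monoidal.

Record unit_decomposition (k : fieldType) (C : monCategory k) (I : finType) :=
  UnitDecomposition {
  uob : I -> C;
  usum : direct_sum uob unitob;
  usimple : forall i, simple_object (uob i);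
  udistinct : forall i j, i != j -> ~ isomorphic (uob i) (uob j)
}.

Section Corner.
Variables (k : fieldType) (C : monCategory k) (I : finType).
Variables (D : unit_decomposition C I) (J : {set I}).

Definition unit_family (j : {i : I | i \in J}) : C := uob D (val j).

(* A choice of the direct sum 1_J. *)
Record partial_unit := PartialUnit {
  oneJ : C;
  oneJ_sum : direct_sum unit_family oneJ
}.

Definition in_Cij (i j : I) X :=
  exists Y, isomorphic X ((uob D i \ox Y) \ox uob D j).

Definition in_CJ X :=
  exists F : {i : I | i \in J} * {j : I | j \in J} -> C,
    (forall ij, in_Cij (val ij.1) (val ij.2) (F ij)) /\
    inhabited (direct_sum F X).

Variable U : partial_unit.

Definition iJ : mor (oneJ U) unitob :=
  \sum_j (dinj (usum D) (val j) \o dproj (oneJ_sum U) j).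
Definition pJ : mor unitob (oneJ U) :=
  \sum_j (dinj (oneJ_sum U) j \o dproj (usum D) (val j)).

Definition XJ X : C := (oneJ U \ox X) \ox oneJ U.

(* i_J \ox Id_X \ox i_J and p_J \ox Id_X \ox p_J, with 1 \ox X \ox 1 identified *)
(* with X by the unit constraints.                                            *)
Definition iXJ X : mor (XJ X) X :=
  run X \o (lun X \oxm idm unitob) \o ((iJ \oxm idm X) \oxm iJ).
Definition pXJ X : mor X (XJ X) :=
  ((pJ \oxm idm X) \oxm pJ) \o (lunI X \oxm idm unitob) \o runI X.

Lemma dproj_iJ j :
  dproj (usum D) (val j) \o iJ = dproj (oneJ_sum U) j.
Proof.
rewrite /iJ mcomp_sumr (bigD1 j) //= mcompA dprojK mcomp1m big1 ?addr0 //.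
move=> i ij; rewrite mcompA dproj0 ?mcomp0l //.
by apply: contra ij => /eqP/val_inj ->.
Qed.

Lemma iJ_dinj j :
  iJ \o dinj (oneJ_sum U) j = dinj (usum D) (val j).
Proof.
rewrite /iJ mcomp_suml (bigD1 j) //= -mcompA dprojK mcompm1 big1 ?addr0 //.
by move=> i ij; rewrite -mcompA dproj0 ?mcomp0r.
Qed.

Lemma iJK : pJ \o iJ = idm (oneJ U).
Proof.
rewrite {1}/pJ mcomp_suml -[RHS](dsum1 (oneJ_sum U)).
by apply: eq_bigr => j _; rewrite -mcompA dproj_iJ.
Qed.

Let eJ := iJ \o pJ.

Lemma eJ_dinj (j : {i : I | i \in J}) :
  eJ \o dinj (usum D) (val j) = dinj (usum D) (val j).
Proof. by rewrite -(iJ_dinj j) mcompA -(mcompA iJ) iJK mcompm1. Qed.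

Definition fixedJ X := actl eJ X = idm X /\ actr eJ X = idm X.

Lemma fixed_mono X Y (f : mor X Y) : is_mono f -> fixedJ Y -> fixedJ X.
Proof.
move=> fm [lY rY]; split; apply: fm.
  by rewrite -actl_nat lY mcomp1m mcompm1.
by rewrite -actr_nat rY mcomp1m mcompm1.
Qed.

Lemma fixed_uob (j : {i : I | i \in J}) : fixedJ (uob D (val j)).
Proof.
have m : is_mono (dinj (usum D) (val j)).
  exact: retraction_mono (dprojK (usum D) (val j)).
by split; apply: m; rewrite -?actl_nat -?actr_nat ?actl1 ?actr1 eJ_dinj mcompm1.
Qed.

Lemma fixed_one : fixedJ (oneJ U).
Proof.
have m : is_mono iJ by exact: retraction_mono iJK.
split; apply: m; rewrite -?actl_nat -?actr_nat ?actl1 ?actr1.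
  by rewrite /eJ -mcompA iJK.
by rewrite /eJ -mcompA iJK.
Qed.

Lemma fixed_tens X Y : fixedJ X -> fixedJ Y -> fixedJ (X \ox Y).
Proof.
by move=> [lX _] [_ rY]; split; rewrite ?actl_tens ?actr_tens ?lX ?rY tens1.
Qed.

Lemma in_CJ_fixed X : in_CJ X -> fixedJ X.
Proof.
case=> F [hF [B]].
have fF ij : fixedJ (F ij).
  have [Y [f [g [gf _]]]] := hF ij.
  apply: (fixed_mono (retraction_mono gf)).
  have [l1 _] := fixed_uob ij.1; have [_ r2] := fixed_uob ij.2.
  by split; rewrite ?actl_tens ?actr_tens ?l1 ?r2 ?tens1.
split; rewrite -[LHS]mcompm1 -(dsum1 B) mcomp_sumr; apply: eq_bigr => t _.
  by rewrite mcompA actl_nat (fF t).1 mcompm1.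
by rewrite mcompA actr_nat (fF t).2 mcompm1.
Qed.

Lemma in_CJ_XJ X : in_CJ (XJ X).
Proof.
exists (fun ij => (uob D (val ij.1) \ox X) \ox uob D (val ij.2)); split.
  move=> ij; exists X, (idm _), (idm _); by rewrite mcomp1m.
constructor.
pose B := oneJ_sum U.
exists (fun ij => (dinj B ij.1 \oxm idm X) \oxm dinj B ij.2)
       (fun ij => (dproj B ij.1 \oxm idm X) \oxm dproj B ij.2).
- by move=> ij; rewrite -!tens_comp !dprojK mcomp1m !tens1.
- case=> [i j] [i' j'] /=; rewrite xpair_eqE negb_and -!tens_comp mcomp1m.
  by case/orP=> ne; rewrite (dproj0 B ne) ?tens0l ?tens0r.
transitivity (((\sum_i (dinj B i \o dproj B i)) \oxm idm X)
    \oxm (\sum_j (dinj B j \o dproj B j))).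
  rewrite !tens_suml; under [RHS]eq_bigr do rewrite tens_sumr.
  rewrite pair_bigA /=; apply: eq_bigr => -[i j] _ /=.
  by rewrite -!tens_comp mcomp1m.
by rewrite dsum1 !tens1.
Qed.

Lemma fixed_in_CJ X : fixedJ X -> in_CJ X.
Proof.
case=> lX rX; have [F [hF [B]]] := in_CJ_XJ X.
exists F; split=> //; constructor.
have lE : lun X \o (eJ \oxm idm X) = lun X by rewrite -actlE lX mcomp1m.
have rE : run X \o (idm X \oxm eJ) = run X by rewrite -actrE rX mcomp1m.
apply: (direct_sum_iso (f := pXJ X) (g := iXJ X)) B.
- rewrite /iXJ /pXJ -!mcompA (mcompA ((iJ \oxm idm X) \oxm iJ)) -!tens_comp.
  rewrite mcomp1m -/eJ (mcompA (lun X \oxm idm unitob)) -tens_comp lE mcomp1m.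
  rewrite (mcompA (lun X \oxm eJ)) -tens_comp lunIK mcompm1.
  by rewrite mcompA rE runIK.
- rewrite /iXJ /pXJ -!mcompA (mcompA (runI X)) runK mcomp1m.
  rewrite (mcompA (lunI X \oxm idm unitob)) -tens_comp lunK.
  rewrite mcomp1m tens1 mcomp1m.
  by rewrite -!tens_comp iJK mcomp1m !tens1.
Qed.

Lemma in_CJ_one : in_CJ (oneJ U).
Proof. exact: fixed_in_CJ fixed_one. Qed.

Lemma in_CJ_tens X Y : in_CJ X -> in_CJ Y -> in_CJ (X \ox Y).
Proof.
by move=> /in_CJ_fixed hX /in_CJ_fixed hY; apply/fixed_in_CJ/fixed_tens.
Qed.

Definition CJ_linCategory : linCategory k :=
  @LinCategory k {X : C | in_CJ X} (fun X Y => mor (sval X) (sval Y))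
    (fun X => idm (sval X)) (fun X Y Z g f => g \o f)
    (fun W X Y Z h g f => mcompA h g f)
    (fun X Y f => mcomp1m f) (fun X Y f => mcompm1 f)
    (fun X Y Z f => @mcomp_linearl k C _ _ (sval Z) f)
    (fun X Y Z g => @mcomp_linearr k C (sval X) _ _ g).

Definition lunJ X : mor (oneJ U \ox X) X := lun X \o (iJ \oxm idm X).
Definition lunIJ X : mor X (oneJ U \ox X) := (pJ \oxm idm X) \o lunI X.
Definition runJ X : mor (X \ox oneJ U) X := run X \o (idm X \oxm iJ).
Definition runIJ X : mor X (X \ox oneJ U) := (idm X \oxm pJ) \o runI X.

Lemma lunJK X : lunIJ X \o lunJ X = idm _.
Proof.
rewrite /lunIJ /lunJ -mcompA (mcompA (lunI X)) lunK mcomp1m.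
by rewrite -tens_compl iJK tens1.
Qed.

Lemma runJK X : runIJ X \o runJ X = idm _.
Proof.
rewrite /runIJ /runJ -mcompA (mcompA (runI X)) runK mcomp1m.
by rewrite -tens_compr iJK tens1.
Qed.

Lemma lunJIK X : in_CJ X -> lunJ X \o lunIJ X = idm X.
Proof.
case/in_CJ_fixed => lX _; rewrite /lunJ /lunIJ -mcompA (mcompA (iJ \oxm _)).
by rewrite -tens_compl mcompA -/eJ -/(actl eJ X) lX.
Qed.

Lemma runJIK X : in_CJ X -> runJ X \o runIJ X = idm X.
Proof.
case/in_CJ_fixed => _ rX; rewrite /runJ /runIJ -mcompA (mcompA (_ \oxm iJ)).
by rewrite -tens_compr mcompA -/eJ -/(actr eJ X) rX.
Qed.

Lemma lunJ_nat X Y (f : mor X Y) :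
  lunJ Y \o (idm (oneJ U) \oxm f) = f \o lunJ X.
Proof.
rewrite /lunJ (mcompA f) -lun_nat -!mcompA -!tens_comp.
by rewrite !mcomp1m !mcompm1.
Qed.

Lemma runJ_nat X Y (f : mor X Y) :
  runJ Y \o (f \oxm idm (oneJ U)) = f \o runJ X.
Proof.
rewrite /runJ (mcompA f) -run_nat -!mcompA -!tens_comp.
by rewrite !mcomp1m !mcompm1.
Qed.

Lemma triangleJ X Y :
  (idm X \oxm lunJ Y) \o assoc X (oneJ U) Y = runJ X \oxm idm Y.
Proof.
rewrite /lunJ /runJ tens_compr tens_compl -mcompA -assoc_nat.
by rewrite mcompA triangle.
Qed.

(* The unit constraints of C_J are i_J \oxm Id_X and Id_X \oxm i_J, composed  *)
(* with the unit constraints of C.                                            *)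
Definition CJ : monCategory k :=
  @MonCategory k CJ_linCategory
    (fun X Y => exist _ (sval X \ox sval Y) (in_CJ_tens (svalP X) (svalP Y)))
    (fun X X' Y Y' f g => f \oxm g)
    (exist _ (oneJ U) in_CJ_one)
    (fun X Y Z => assoc (sval X) (sval Y) (sval Z))
    (fun X Y Z => assocI (sval X) (sval Y) (sval Z))
    (fun X => lunJ (sval X)) (fun X => lunIJ (sval X))
    (fun X => runJ (sval X)) (fun X => runIJ (sval X))
    (fun X Y => tens1 (sval X) (sval Y))
    (fun X X' X'' Y Y' Y'' f' f g' g => tens_comp f' f g' g)
    (fun X X' Y Y' g => @tens_linearl k C (sval X) (sval X') _ _ g)
    (fun X X' Y Y' f => @tens_linearr k C _ _ (sval Y) (sval Y') f)
    (fun X Y Z => assocK (sval X) (sval Y) (sval Z))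
    (fun X Y Z => assocIK (sval X) (sval Y) (sval Z))
    (fun X => lunJK (sval X)) (fun X => lunJIK (svalP X))
    (fun X => runJK (sval X)) (fun X => runJIK (svalP X))
    (fun X X' Y Y' Z Z' f g h => assoc_nat f g h)
    (fun X Y f => lunJ_nat f) (fun X Y f => runJ_nat f)
    (fun W X Y Z => pentagon (sval W) (sval X) (sval Y) (sval Z))
    (fun X Y => triangleJ (sval X) (sval Y)).

(* X_J as an object of C_J. *)
Definition CJ_ob (X : C) : CJ := exist _ (XJ X) (in_CJ_XJ X).

End Corner.

(* Main.v *)
Require Import Defs.
From HB Require Import structures.
From mathcomp Require Import all_boot all_algebra.

Set Implicit Arguments.
Unset Strict Implicit.
Unset Printing Implicit Defensive.

Local Open Scope cat_scope.

(** The endomorphism [iJ \o pJ] of the unit is the idempotent cutting out 1_J.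
    It acts on every object X from the left and from the right, both actions
    are natural in X, and X_J is the image of X under the idempotent [cutJ]
    obtained by composing them: the canonical maps i = [iXJ] and p = [pXJ] split
    it ([iXJ_pXJ], [pXJ_iXJ]).  The structure maps of the corner are therefore
    obtained by conjugating those of A:

      m_J = p m (i \ox i),     u_J = p u i_J,
      d_J = (p \ox p) d i,     e_J = p_J e i.

    What has to be seen is that the idempotent i p arising from these formulas
    can be absorbed.  For m and d the reason is that on a tensor product
    X \ox Y the left action only touches X and the right action only touches Y
    ([cutJ_tens]); with naturality, cutting the target of m (i \ox i) amounts to
    acting on the two copies of A_J, where the idempotent acts trivially.  For u
    and e, on the unit object both actions are the idempotent itself
    ([cutJ_unit]).  The axioms in the corner then follow from those of A,
    because i is a monomorphism and p is an epimorphism ([mono_is_algebraJ],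
    [epi_is_coalgebraJ]).

    In the algebra case, i u_J = u i_J.  Hence i u_J p_J is u composed with the
    idempotent, and it is u itself only if u vanishes on the summands 1_i with i
    outside J. *)

Section Corner.
Variables (k : fieldType) (C : monCategory k) (I : finType).
Variables (D : unit_decomposition C I) (J : {set I}) (U : partial_unit D J).
Implicit Types X Y A : C.

Local Notation eJ := (iJ U \o pJ U).
Local Notation iX := (iXJ U).
Local Notation pX := (pXJ U).

(** * The idempotent splitting off X_J *)

Definition cutJ X : mor X X := actl eJ X \o actr eJ X.

Lemma iXJ_pXJ X : iX X \o pX X = cutJ X.
Proof.
rewrite /iXJ /pXJ -!mcompA (mcompA ((iJ U \oxm idm X) \oxm iJ U)) -!tens_comp.
rewrite mcomp1m (mcompA (lun X \oxm idm unitob)) -tens_comp mcomp1m.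
rewrite (mcompA (_ \oxm eJ)) -tens_comp mcompm1 -/(actl eJ X).
(* The unit constraint lets the two idempotents act one after the other. *)
have -> : actl eJ X \oxm eJ = (actl eJ X \oxm idm unitob) \o (idm X \oxm eJ).
  by rewrite -tens_comp mcomp1m mcompm1.
by rewrite !mcompA run_nat -!mcompA /cutJ /actr -!mcompA.
Qed.

Lemma pXJ_iXJ X : pX X \o iX X = idm (XJ U X).
Proof.
rewrite /iXJ /pXJ -!mcompA (mcompA (runI X)) runK mcomp1m.
rewrite (mcompA (lunI X \oxm idm unitob)) -tens_comp lunK.
by rewrite mcomp1m tens1 mcomp1m -!tens_comp iJK mcomp1m !tens1.
Qed.

Lemma iXJ_mono X : is_mono (iX X).
Proof. exact: retraction_mono (pXJ_iXJ X). Qed.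

Lemma pXJ_epi X : is_epi (pX X).
Proof. exact: section_epi (pXJ_iXJ X). Qed.

Lemma fixedJ_XJ X : fixedJ U (XJ U X).
Proof. exact/in_CJ_fixed/in_CJ_XJ. Qed.

Lemma actl_iXJ X : actl eJ X \o iX X = iX X.
Proof. by rewrite actl_nat (fixedJ_XJ X).1 mcompm1. Qed.

Lemma actr_iXJ X : actr eJ X \o iX X = iX X.
Proof. by rewrite actr_nat (fixedJ_XJ X).2 mcompm1. Qed.

Lemma pXJ_actl X : pX X \o actl eJ X = pX X.
Proof. by rewrite -actl_nat (fixedJ_XJ X).1 mcomp1m. Qed.

Lemma pXJ_actr X : pX X \o actr eJ X = pX X.
Proof. by rewrite -actr_nat (fixedJ_XJ X).2 mcomp1m. Qed.

Lemma cutJ_nat X Y (f : mor X Y) : cutJ Y \o f = f \o cutJ X.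
Proof. by rewrite /cutJ -mcompA actr_nat mcompA actl_nat mcompA. Qed.

(** The inner sides of the two factors are not cut; in general X_J \ox X_J is
    therefore a proper summand of (X \ox X)_J. *)
Lemma cutJ_tens X Y : cutJ (X \ox Y) = actl eJ X \oxm actr eJ Y.
Proof.
by rewrite /cutJ actl_tens actr_tens -tens_comp mcomp1m mcompm1.
Qed.

Lemma eJ_idem : eJ \o eJ = eJ.
Proof. by rewrite mcompA -(mcompA (iJ U)) iJK mcompm1. Qed.

Lemma cutJ_unit : cutJ unitob = eJ.
Proof. by rewrite /cutJ actl1 actr1 eJ_idem. Qed.

(** * The corner of an algebra *)

Section Algebra.
Variables (A : C) (m : mor (A \ox A) A) (u : mor unitob A).

(** Along a monomorphism compatible with the structure maps, each axiom of B is
    a restriction of the same axiom of A: the unit constraints of the corner are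
    those of the ambient category preceded by i_J. *)
Lemma mono_is_algebraJ (B : CJ U) (i : mor (sval B) A)
    (mJ : mor (sval B \ox sval B) (sval B)) (uJ : mor (oneJ U) (sval B)) :
  is_mono i -> i \o mJ = m \o (i \oxm i) -> i \o uJ = u \o iJ U ->
  is_algebra m u -> @is_algebra k (CJ U) B mJ uJ.
Proof.
move=> i_mono imJ iuJ [mA mul1 mulr1]; split; apply: i_mono.
- change (i \o (mJ \o (mJ \oxm idm (sval B))) =
    i \o (mJ \o (idm (sval B) \oxm mJ) \o assoc (sval B) (sval B) (sval B))).
  transitivity (m \o (m \oxm idm A) \o ((i \oxm i) \oxm i)).
    rewrite mcompA imJ -mcompA -tens_comp imJ mcompm1.
    by rewrite -mcompA -tens_comp mcomp1m.
  rewrite mA -(mcompA _ (assoc A A A)) assoc_nat !mcompA imJ; congr (_ \o _).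
  by rewrite -!mcompA -!tens_comp imJ mcompm1 mcomp1m.
- change (i \o (mJ \o (uJ \oxm idm (sval B))) =
    i \o (lun (sval B) \o (iJ U \oxm idm (sval B)))).
  transitivity (m \o (u \oxm idm A) \o (iJ U \oxm i)).
    by rewrite mcompA imJ -!mcompA -!tens_comp iuJ mcompm1 mcomp1m.
  by rewrite mul1 mcompA -lun_nat -mcompA -tens_comp mcomp1m mcompm1.
- change (i \o (mJ \o (idm (sval B) \oxm uJ)) =
    i \o (run (sval B) \o (idm (sval B) \oxm iJ U))).
  transitivity (m \o (idm A \oxm u) \o (i \oxm iJ U)).
    by rewrite mcompA imJ -!mcompA -!tens_comp iuJ mcompm1 mcomp1m.
  by rewrite mulr1 mcompA -run_nat -mcompA -tens_comp mcomp1m mcompm1.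
Qed.

Lemma corner_algebra : is_algebra m u ->
  exists (mJ : mor (XJ U A \ox XJ U A) (XJ U A)) (uJ : mor (oneJ U) (XJ U A)),
    [/\ @is_algebra k (CJ U) (CJ_ob U A) mJ uJ,
        iX A \o mJ = m \o (iX A \oxm iX A) & iX A \o uJ = u \o iJ U].
Proof.
move=> mu; exists (pX A \o m \o (iX A \oxm iX A)), (pX A \o u \o iJ U).
have imJ : iX A \o (pX A \o m \o (iX A \oxm iX A)) = m \o (iX A \oxm iX A).
  rewrite 2!mcompA iXJ_pXJ cutJ_nat cutJ_tens -mcompA -tens_comp.
  by rewrite actl_iXJ actr_iXJ.
have iuJ : iX A \o (pX A \o u \o iJ U) = u \o iJ U.
  by rewrite 2!mcompA iXJ_pXJ cutJ_nat cutJ_unit -2!mcompA iJK mcompm1.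
by split=> //; exact: (@mono_is_algebraJ (CJ_ob U A) (iX A) _ _ (@iXJ_mono A)).
Qed.

End Algebra.

(** * The corner of a coalgebra *)

Section Coalgebra.
Variables (A : C) (d : mor A (A \ox A)) (e : mor A unitob).

(** Dually, along an epimorphism compatible with the structure maps.
    Coassociativity is inherited at once; in the counit axioms an idempotent is
    left over on one side of B, where it acts trivially because B lies in the
    corner. *)
Lemma epi_is_coalgebraJ (B : CJ U) (p : mor A (sval B))
    (dJ : mor (sval B) (sval B \ox sval B)) (epsJ : mor (sval B) (oneJ U)) :
  is_epi p -> dJ \o p = (p \oxm p) \o d -> epsJ \o p = pJ U \o e ->
  is_coalgebra d e -> @is_coalgebra k (CJ U) B dJ epsJ.
Proof.
have [Bl Br] := in_CJ_fixed U (svalP B).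
move=> p_epi dJp eJp [dA comul1 comulr1]; split; apply: p_epi.
- change (assoc (sval B) (sval B) (sval B)
      \o (dJ \oxm idm (sval B)) \o dJ \o p =
    (idm (sval B) \oxm dJ) \o dJ \o p).
  transitivity ((p \oxm (p \oxm p)) \o (assoc A A A \o (d \oxm idm A) \o d)).
    rewrite !mcompA -assoc_nat -!mcompA dJp; congr (_ \o _).
    by rewrite !mcompA -!tens_comp dJp mcomp1m mcompm1.
  rewrite dA -mcompA dJp !mcompA; congr (_ \o _).
  by rewrite -!tens_comp dJp mcomp1m mcompm1.
- change (lun (sval B) \o (iJ U \oxm idm (sval B))
      \o (epsJ \oxm idm (sval B)) \o dJ \o p = idm (sval B) \o p).
  (* The idempotent comes out in front, as the left action on B. *)
  transitivity (actl (iJ U \o pJ U) (sval B) \o p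
      \o (lun A \o (e \oxm idm A) \o d)).
    rewrite !mcompA -(mcompA _ p) -lun_nat mcompA actlE -!mcompA dJp.
    congr (_ \o _); rewrite !mcompA -!tens_comp; congr (_ \o _).
    by rewrite -!mcompA eJp !mcomp1m !mcompm1.
  by rewrite comul1 mcompm1 Bl.
- change (run (sval B) \o (idm (sval B) \oxm iJ U)
      \o (idm (sval B) \oxm epsJ) \o dJ \o p = idm (sval B) \o p).
  transitivity (actr (iJ U \o pJ U) (sval B) \o p
      \o (run A \o (idm A \oxm e) \o d)).
    rewrite !mcompA -(mcompA _ p) -run_nat mcompA actrE -!mcompA dJp.
    congr (_ \o _); rewrite !mcompA -!tens_comp; congr (_ \o _).
    by rewrite -!mcompA eJp !mcomp1m !mcompm1.
  by rewrite comulr1 mcompm1 Br.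
Qed.

Lemma corner_coalgebra : is_coalgebra d e ->
  exists (dJ : mor (XJ U A) (XJ U A \ox XJ U A)) (epsJ : mor (XJ U A) (oneJ U)),
    [/\ @is_coalgebra k (CJ U) (CJ_ob U A) dJ epsJ,
        dJ \o pX A = (pX A \oxm pX A) \o d & epsJ \o pX A = pJ U \o e].
Proof.
move=> de; exists ((pX A \oxm pX A) \o d \o iX A), (pJ U \o e \o iX A).
have dJp : (pX A \oxm pX A) \o d \o iX A \o pX A = (pX A \oxm pX A) \o d.
  rewrite -2!mcompA iXJ_pXJ -cutJ_nat cutJ_tens mcompA -tens_comp.
  by rewrite pXJ_actl pXJ_actr.
have eJp : pJ U \o e \o iX A \o pX A = pJ U \o e.
  by rewrite -2!mcompA iXJ_pXJ -cutJ_nat cutJ_unit 2!mcompA iJK mcomp1m.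
by split=> //; exact: (@epi_is_coalgebraJ (CJ_ob U A) (pX A) _ _ (@pXJ_epi A)).
Qed.

End Coalgebra.

End Corner.

Theorem proposition5p10 (k : closedFieldType) (C : monCategory k)
  (hC : multiring C) (hD : has_left_duals C)
  (I : finType) (D : unit_decomposition C I)
  (J : {set I}) (hJ : J != set0) (U : partial_unit D J) :
  (forall (A : C) (m : mor (A \ox A) A) (u : mor unitob A), is_algebra m u ->
     exists (mJ : mor (XJ U A \ox XJ U A) (XJ U A))
            (uJ : mor (oneJ U) (XJ U A)),
       [/\ @is_algebra k (CJ U) (CJ_ob U A) mJ uJ,
           iXJ U A \o mJ = m \o (iXJ U A \oxm iXJ U A)
         & iXJ U A \o uJ \o pJ U = u \o iJ U \o pJ U])
  /\
  (forall (A : C) (d : mor A (A \ox A)) (e : mor A unitob), is_coalgebra d e ->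
     exists (dJ : mor (XJ U A) (XJ U A \ox XJ U A))
            (eJ : mor (XJ U A) (oneJ U)),
       [/\ @is_coalgebra k (CJ U) (CJ_ob U A) dJ eJ,
           dJ \o pXJ U A = (pXJ U A \oxm pXJ U A) \o d
         & iJ U \o eJ \o pXJ U A = iJ U \o pJ U \o e]).
Proof.
split=> [A m u | A d e].
  case/(corner_algebra U) => mJ [uJ [mu imJ iuJ]].
  by exists mJ, uJ; split; rewrite ?iuJ.
case/(corner_coalgebra U) => dJ [epsJ [de dJp eJp]].
by exists dJ, epsJ; split; rewrite // -mcompA eJp mcompA.
Qed.
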